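(* Let $D$ be a pre-divergence on a Polish space $\mathcal{X}$ and $c$ a cost function such that (1) whenever $\mu_n,\mu\in\mathcal{P}(\mathcal{X})$ satisfy $D(\mu_n\|\mu)\to0$, then $\mu_n\to\mu$ weakly; and (2) $c(x_1,x_2)=0$ if and only if $x_1=x_2$. Then $D^c$ has the divergence property: for all $\mu,\nu\in\mathcal{P}(\mathcal{X})$, $D^c(\nu\|\mu)=0$ if and only if $\nu=\mu$.
   Context: $\mathcal{P}(\mathcal{X})$ is the set of Borel probability measures on the Polish space $\mathcal{X}$, with the weak convergence topology. A pre-divergence is $D:\mathcal{P}(\mathcal{X})\times\mathcal{P}(\mathcal{X})\to[0,\infty]$ with $D(\mu\|\mu)=0$ for all $\mu$. A cost function is a lower semicontinuous $c:\mathcal{X}\times\mathcal{X}\to[0,\infty]$, with OT cost $C(\mu,\nu)=\inf\{\int c\,d\pi:\pi\in\mathcal{P}(\mathcal{X}\times\mathcal{X}),\pi_1=\mu,\pi_2=\nu\}$. $D^c(\nu\|\mu)=\inf_{\eta\in\mathcal{P}(\mathcal{X})}\{D(\eta\|\mu)+C(\eta,\nu)\}$. *)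

(* Defs.v *)
From HB Require Import structures.
From mathcomp Require Import all_boot all_order all_algebra.
From mathcomp Require Import all_classical all_reals all_analysis.
Set Implicit Arguments. Unset Strict Implicit. Unset Printing Implicit Defensive.
Import Order.TTheory GRing.Theory Num.Theory.
Import numFieldNormedType.Exports.
Local Open Scope classical_set_scope.
Local Open Scope ring_scope.

Definition polish (R : realType) (X : topologicalType) : Prop :=
  (exists d : X -> X -> R,
     [/\ (forall x y, 0 <= d x y) /\ (forall x y, d x y = 0 <-> x = y),
         (forall x y, d x y = d y x),
         (forall x y z, d x z <= d x y + d y z),
         (forall A : set X, open A <->
            (forall x, A x -> exists2 e : R, 0 < e & [set y | d x y < e] `<=` A)) &
         (forall u : nat -> X,
            (forall e : R, 0 < e -> exists N : nat,
               forall m n, (N <= m)%N -> (N <= n)%N -> d (u m) (u n) < e) ->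
            exists x : X, u @ \oo --> x)])
  /\ (exists S : set X, countable S /\ dense S).

Definition Borel (X : ptopologicalType) := g_sigma_algebraType (@open X).

Definition Prob (R : realType) (X : ptopologicalType) := probability (Borel X) R.

Definition meq (R : realType) (X : ptopologicalType) (mu nu : Prob R X) : Prop :=
  forall A : set (Borel X), measurable A -> mu A = nu A.

Definition weak_cvg (R : realType) (X : ptopologicalType)
  (mu_ : nat -> Prob R X) (mu : Prob R X) : Prop :=
  forall f : X -> R, continuous f -> (exists M : R, forall x, `|f x| <= M) ->
    (fun n => (\int[mu_ n]_x (f x)%:E)%E) @ \oo --> (\int[mu]_x (f x)%:E)%E.

Definition pre_divergence (R : realType) (X : ptopologicalType)
  (D : Prob R X -> Prob R X -> \bar R) : Prop :=
  (forall mu nu, (0 <= D mu nu)%E) /\ (forall mu, D mu mu = 0%E).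

Definition cost_function (R : realType) (X : ptopologicalType)
  (c : X * X -> \bar R) : Prop :=
  lower_semicontinuous c /\ (forall z, (0 <= c z)%E).

Definition coupling (R : realType) (X : ptopologicalType) (mu nu : Prob R X)
  (pi : probability (Borel X * Borel X)%type R) : Prop :=
  (forall A : set (Borel X), measurable A -> pi (fst @^-1` A) = mu A) /\
  (forall A : set (Borel X), measurable A -> pi (snd @^-1` A) = nu A).

Definition OTcost (R : realType) (X : ptopologicalType)
  (c : X * X -> \bar R) (mu nu : Prob R X) : \bar R :=
  ereal_inf [set (\int[pi]_z c z)%E | pi in coupling mu nu].

Definition Dc (R : realType) (X : ptopologicalType)
  (D : Prob R X -> Prob R X -> \bar R) (c : X * X -> \bar R)
  (nu mu : Prob R X) : \bar R :=
  ereal_inf [set (D eta mu + OTcost c eta nu)%E | eta in [set: Prob R X]].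

(* Main.v *)
(* If D^c(nu||mu) = 0, there are eta_n with D(eta_n||mu) -> 0, so eta_n -> mu
   weakly, and C(eta_n, nu) -> 0.  Prokhorov's theorem is not needed to conclude
   that mu = nu.  Let K be compact.  Since c is lower semicontinuous and positive
   off the diagonal, every y outside K has a neighbourhood G such that c >= a > 0
   on U x G for some open U containing K, and finite unions of such G still have
   this property.  A coupling of eta_n and nu with small cost gives little mass to
   U x G, so eta_n(U) + nu(G) is at most 1 + o(1).  Letting n -> oo yields
   mu(K) + nu(G) <= 1, and countably many G cover the complement of K, so
   mu(K) <= nu(K).  By tightness of mu this extends to closed sets, and then mu and
   nu agree on open sets.  For the converse take eta = mu and the diagonal
   coupling. *)
Require Import Defs.
From HB Require Import structures.
From mathcomp Require Import all_boot all_order all_algebra.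
From mathcomp Require Import all_classical all_reals all_analysis.
From mathcomp Require Import measurable_realfun lra.
Import Order.TTheory GRing.Theory Num.Theory.
Import numFieldNormedType.Exports.
Local Open Scope classical_set_scope.
Local Open Scope ring_scope.

Set Implicit Arguments.
Unset Strict Implicit.
Unset Printing Implicit Defensive.

(** * Metric topology and compactness *)

Section MetricTopology.
Context (R : realType) (X : ptopologicalType).
Implicit Types (d : X -> X -> R) (A K : set X).

Record metrizes d : Prop := Metrizes {
  dist_ge0 : forall x y, 0 <= d x y ;
  dist_eq0 : forall x y, d x y = 0 <-> x = y ;
  dist_sym : forall x y, d x y = d y x ;
  dist_triangle : forall x y z, d x z <= d x y + d y z ;
  open_dist : forall A, open A <->
    (forall x, A x -> exists2 e : R, 0 < e & [set y | d x y < e] `<=` A) }.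

Definition cauchy_complete d : Prop := forall u : nat -> X,
  (forall e : R, 0 < e -> exists N : nat,
     forall m n, (N <= m)%N -> (N <= n)%N -> d (u m) (u n) < e) ->
  exists x : X, u @ \oo --> x.

(** Together with closedness and [cauchy_complete], this is compactness, in the form that Ulam's
    construction delivers. *)
Definition tot_bounded d K : Prop := forall e : R, 0 < e ->
  exists t : seq X, forall x, K x -> exists2 y, y \in t & d y x < e.

Lemma distxx d x : metrizes d -> d x x = 0.
Proof. by move=> md; apply/(dist_eq0 md). Qed.

Lemma nbhs_dist d x A : metrizes d ->
  nbhs x A <-> exists2 e : R, 0 < e & [set y | d x y < e] `<=` A.
Proof.
move=> md; rewrite nbhsE; split=> [[B [oB Bx] BA]|[e e0 eA]].
  have [e e0 eB] := (open_dist md B).1 oB x Bx.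
  by exists e => //; exact: subset_trans BA.
exists [set y | d x y < e] => //; split; last by rewrite /= distxx.
apply/(open_dist md) => y /= xy; exists (e - d x y); first by rewrite subr_gt0.
by move=> z /= yz; have := dist_triangle md x y z; lra.
Qed.

Lemma open_ball_dist d x (e : R) : metrizes d -> open [set y | d x y < e].
Proof.
move=> md; apply/(open_dist md) => y /= xy.
exists (e - d x y); first by rewrite subr_gt0.
by move=> z /= yz; have := dist_triangle md x y z; lra.
Qed.

Lemma open_ballC_dist d x (e : R) : metrizes d -> open [set y | e < d x y].
Proof.
move=> md; apply/(open_dist md) => y /= xy.
exists (d x y - e); first by rewrite subr_gt0.
move=> z /= yz; have := dist_triangle md x z y; rewrite (dist_sym md z y); lra.
Qed.

Lemma continuous_dist d x : metrizes d -> continuous (d x).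
Proof.
move=> md y; apply/cvgrPdist_lt => e e0.
apply/(nbhs_dist _ _ md); exists e => // z /= yz; rewrite ltr_norml.
have := dist_triangle md x z y; have := dist_triangle md x y z.
by rewrite (dist_sym md z y); lra.
Qed.

Lemma dense_seq : (exists S : set X, countable S /\ dense S) ->
  exists s : nat -> X, forall O : set X, open O -> O !=set0 -> exists n, O (s n).
Proof.
move=> [S [/countable_injP[f finj] dS]].
(* The enumeration inverts the injection [f] on [S]; outside the image of [S] the value [point] is
   harmless. *)
exists (fun n => xget point [set x | S x /\ f x = n]) => O oO O0.
have [x [Ox Sx]] := dS O O0 oO.
exists (f x); case: xgetP => [y _ [Sy fyx]|/(_ x)]; last by move=> /(_ (conj Sx erefl)).
by rewrite (finj y x) ?inE.
Qed.

Lemma vanishing_radii : exists r : nat -> R,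
  [/\ forall k, 0 < r k, forall m n, (m <= n)%N -> r n <= r m &
      forall e, 0 < e -> exists k, r k < e].
Proof.
exists (fun k => k.+1%:R^-1); split=> [k|m n mn|e e0]; first by rewrite invr_gt0.
  by rewrite lef_pV2 ?posrE ?ler_nat.
have [N _ NP] := near_infty_natSinv_lt (PosNum e0).
by exists N; apply: (NP N) => /=.
Qed.

(* Compactness of [K], used as an induction principle over sets instead of
   extracting finite subcovers. *)
Lemma tot_bounded_ind d K (P : set X -> Prop) :
  metrizes d -> cauchy_complete d -> closed K -> tot_bounded d K ->
  P set0 ->
  (forall A B, A `<=` B -> P B -> P A) ->
  (forall A B, P A -> P B -> P (A `|` B)) ->
  (forall x, K x -> exists2 A, nbhs x A & P A) ->
  P K.
Proof.
move=> md cd cK tK P0 PS PU Ploc; apply: contrapT => nPK.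
have [r [r0 _ rsmall]] := vanishing_radii.
(* Finitely many small balls cover [A] and [P] passes to unions, so if [P] fails on [A] it fails on
   the part of [A] in one of them. *)
have split_ball A (e : R) : A `<=` K -> ~ P A -> 0 < e ->
    exists y, ~ P (A `&` [set x | d y x < e]).
  move=> AK nPA e0; apply/not_existsP => Pball; apply: nPA.
  have [t tP] := tK _ e0.
  have: P (A `&` [set x | exists2 y, y \in t & d y x < e]).
    elim: t {tP} => [|y t IH]; first by apply: PS P0 => x [_ []].
    apply: PS (PU _ _ (contrapT (Pball y)) IH) => x [Ax [z]].
    rewrite inE => /orP[/eqP-> yx|zt zx]; first by left.
    by right; split => //; exists z.
  by apply: PS => x Ax; split => //; apply: tP; exact: AK.
have /choice[g gP] : forall kA : nat * set X, exists y : X,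
    kA.2 `<=` K -> ~ P kA.2 -> ~ P (kA.2 `&` [set x | d y x < r kA.1]).
  move=> [k A] /=; have [AK|nAK] := pselect (A `<=` K); last by exists point.
  have [PA|nPA] := pselect (P A); first by exists point.
  by have [y yP] := split_ball A _ AK nPA (r0 k); exists y.
(* Nested sets of vanishing diameter on which [P] fails, nonempty since [P set0]. Points chosen in
   them form a Cauchy sequence, and a good neighbourhood of its limit swallows some [A_ k]. *)
pose A_ := fix A_ k := if k is n.+1 then
  A_ n `&` [set x | d (g (n, A_ n)) x < r n] else K.
have AS k x : A_ k.+1 x -> A_ k x /\ d (g (k, A_ k)) x < r k by [].
have AP k : A_ k `<=` K /\ ~ P (A_ k).
  elim: k => [|k [IK IP]]; first by split.
  split; first by move=> x Ax; exact: IK (AS k x Ax).1.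
  exact: (gP (k, A_ k)).
have Adecr m n : (m <= n)%N -> A_ n `<=` A_ m.
  elim: n => [|n IH]; first by rewrite leqn0 => /eqP->.
  by rewrite leq_eqVlt => /orP[/eqP->//|/IH mn] x Ax; exact: mn (AS n x Ax).1.
have /choice[u uA] : forall k, exists x, A_ k x.
  move=> k; apply: contrapT => /forallNP nA; apply: (AP k).2.
  by apply: PS P0 => x /nA.
have Adiam k x y : A_ k.+1 x -> A_ k.+1 y -> d x y < r k + r k.
  move=> /(AS k x)[_ gx] /(AS k y)[_ gy].
  move: (g _) gx gy => z zx zy.
  by have := dist_triangle md x z y; rewrite (dist_sym md x z); lra.
have small e : 0 < e -> exists k, forall x y, A_ k x -> A_ k y -> d x y < e.
  move=> e0; have /rsmall[k ke] : 0 < e / 2 by lra.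
  by exists k.+1 => x y Ax Ay; have := Adiam k x y Ax Ay; lra.
have [x ux] : exists x : X, u @ \oo --> x.
  apply: cd => e /small[k kP]; exists k => m n km kn.
  by apply: kP; [apply: (Adecr k m)|apply: (Adecr k n)] => //; exact: uA.
have Kx : K x.
  apply: (@closed_cvg _ _ _ _ u K cK _ x ux).
  by apply: nearW => n; exact: (AP n).1.
have [W Wx PW] := Ploc x Kx.
have [e e0 eW] := (nbhs_dist x W md).1 Wx.
have /small[k kP] : 0 < e / 2 by lra.
apply: (AP k).2; apply: PS PW => y Ay; apply: eW => /=.
have : \forall n \near \oo, d x (u n) < e / 2.
  by apply: (ux [set z | d x z < e / 2]); apply/(nbhs_dist _ _ md); exists (e / 2) => //; lra.
move=> [N _ /(_ (maxn N k))]/(_ (leq_maxl _ _)) /= xu.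
have Au : A_ k (u (maxn N k)) by apply: (Adecr k _ (leq_maxr _ _)); exact: uA.
by have := dist_triangle md x (u (maxn N k)) y; have := kP _ _ Au Ay; lra.
Qed.

End MetricTopology.

(** * Borel sets, continuity from below and tightness *)

Section BorelMeasures.
Context (R : realType) (X : ptopologicalType).
Implicit Types (O K : set X) (f : X -> R) (mu : Prob R X).

Lemma open_measurable_Borel O : open O -> measurable (O : set (Borel X)).
Proof. by move=> oO; exact: sub_sigma_algebra. Qed.

Lemma closed_measurable_Borel K : closed K -> measurable (K : set (Borel X)).
Proof.
move=> cK; rewrite -[K]setCK; apply: measurableC; apply: open_measurable_Borel.
by rewrite openC.
Qed.

Lemma continuous_measurable_Borel f : continuous f ->
  measurable_fun [set: Borel X] (f : Borel X -> R).
Proof.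
move=> cf; apply: (measurability _ (RGenOpens.measurableE R)).
move=> _ [_ [x [y ->]] <-]; rewrite setTI; apply: open_measurable_Borel.
by move/continuousP : cf; apply; exact: interval_open.
Qed.

Lemma measure_le_exhaustion d (T : measurableType d) (mu : measure T R)
    (F : nat -> set T) (A : set T) (b : \bar R) :
  (forall n, measurable (F n)) -> {homo F : m n / (m <= n)%N >-> m `<=` n} ->
  measurable A -> A `<=` \bigcup_n F n -> (forall n, (mu (F n) <= b)%E) ->
  (mu A <= b)%E.
Proof.
move=> mF ndF mA AF Fb.
have mUF : measurable (\bigcup_n F n) by exact: bigcupT_measurable.
apply: (@le_trans _ _ (mu (\bigcup_n F n))); first by apply: le_measure; rewrite ?inE.
have ndF' : {homo F : m n / (m <= n)%N >-> (m <= n)%O}.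
  by move=> m n /ndF; rewrite subsetEset.
by apply: cvge_to_le (nondecreasing_cvg_mu mF mUF ndF') _; apply: nearW => n /=.
Qed.

(* Ulam's theorem: [K] is an intersection of finite unions of closed balls whose
   radii tend to 0, each of them missing little mass. *)
Lemma tightness (dist : X -> X -> R) mu (e : R) :
  metrizes dist -> (exists S : set X, countable S /\ dense S) -> 0 < e ->
  exists K, [/\ closed K, tot_bounded dist K & (mu (~` K) <= e%:E)%E].
Proof.
move=> md /dense_seq[s sdense] e0.
have [rad [rad0 _ rsmall]] := @vanishing_radii R.
pose F (r : R) N := \big[setU/set0]_(i < N) [set x | dist (s i) x <= r].
have cF r N : closed (F r N).
  apply: closed_bigsetU => i _; rewrite -openC.
  rewrite (_ : ~` _ = [set x | r < dist (s i) x]); first exact: open_ballC_dist.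
  by apply/seteqP; split => x /=; rewrite real_ltNge ?num_real// => /negP.
have mF r N : measurable (F r N : set (Borel X)) by exact: closed_measurable_Borel.
(* By density the sets [F r N] increase to the whole space, so they cannot all have mass below
   [1 - c]. *)
have Fbig r c : 0 < r -> 0 < c -> exists N, (mu (~` F r N) <= c%:E)%E.
  move=> r0 c0; apply: contrapT => /forallNP nF.
  suff : (mu setT <= (1 - c)%:E)%E by rewrite probability_setT lee_fin; lra.
  apply: (@measure_le_exhaustion _ _ mu (F r)) => //.
  - by move=> m n; exact: (@subset_bigsetU _ (fun i => [set x | dist (s i) x <= r])).
  - move=> x _; have [|n sx] := sdense _ (open_ball_dist x r md).
      by exists x; rewrite /= distxx.
    exists n.+1 => //; rewrite /F big_ord_recr /=; right => /=.
    by rewrite (dist_sym md) ltW.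
  - move=> N; have /negP := nF N; rewrite -ltNge probability_setC//.
    rewrite -[leLHS]/(mu (F r N)) -(fineK (fin_num_measure mu (F r N) (mF r N))).
    by rewrite -EFinB lte_fin lee_fin; lra.
have /choice[N NP] k : exists N, (mu (~` F (rad k) N) <= (e / (2 ^ k.+1)%:R)%:E)%E.
  apply: Fbig; first exact: rad0.
  by rewrite divr_gt0// ltr0n expn_gt0.
pose K := \bigcap_k F (rad k) (N k).
exists K; split.
- by apply: (@closed_bigI _ _ setT) => k _; exact: cF.
(* The centres of the balls in the single factor [F (rad k) (N k)] form a finite net. *)
- move=> c /rsmall[k kc]; exists [seq s i | i <- iota 0 (N k)] => x /(_ k I).
  rewrite /F -(bigcup_mkord _ (fun i => [set x | dist (s i) x <= rad k])) => -[i /= iN six]; exists (s i); last exact: le_lt_trans kc.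
  by apply: map_f; rewrite mem_iota.
- rewrite setC_bigcap.
  apply: le_trans (measure_sigma_subadditive mu (F := fun k => ~` F (rad k) (N k)) _ _ _) _.
  + by move=> k; exact: measurableC.
  + by apply: bigcupT_measurable => k; exact: measurableC.
  + by [].
  (* Applied to the zero sequence, this sums the shares [e / 2 ^ k.+1] to at most [e]. *)
  + have := @epsilon_trick R (fun=> 0%E) e xpredT (fun=> lexx _) (ltW e0).
    rewrite [X in (_ <= X + _)%E]eseries0// add0e; apply: le_trans.
    apply: lee_nneseries => // k _.
    by rewrite add0e; exact: NP.
Qed.

End BorelMeasures.

(** * Sets separated by a positive lower bound on the cost *)

Section Separation.
Context (R : realType) (X : ptopologicalType) (c : X * X -> \bar R).
Implicit Types (K G A B : set X).

(* Only the continuous function [f] is needed from an open neighbourhood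
   [{f > 0}] of [K], because it can be tested against weak convergence. *)
Definition separating K G (f : X -> R) (a : R) : Prop :=
  [/\ continuous f, (forall x, 0 <= f x <= 1), (forall x, K x -> f x = 1),
      0 < a & forall x y, 0 < f x -> G y -> (a%:E <= c (x, y))%E].

Definition separated K G : Prop := exists f a, separating K G f a.

Lemma separated0l G : separated set0 G.
Proof.
exists (cst 0), 1; split=> //; first exact: cst_continuous.
  by move=> x; rewrite lexx ler01.
by move=> x y; rewrite ltxx.
Qed.

Lemma separated0r K : separated K set0.
Proof.
exists (cst 1), 1; split=> //; first exact: cst_continuous.
by move=> x; rewrite lexx ler01.
Qed.

Lemma separatedS A B G H : A `<=` B -> G `<=` H -> separated B H -> separated A G.
Proof.
move=> AB GH [f [a [cf f01 f1 a0 fa]]]; exists f, a; split=> // [x /AB/f1//|].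
by move=> x y fx /GH; exact: fa.
Qed.

(** Where the maximum of the two functions is positive, one of them is, and its bound on [c]
    applies. *)
Lemma separatedUl A B G : separated A G -> separated B G -> separated (A `|` B) G.
Proof.
move=> [f [a [cf f01 f1 a0 fa]]] [g [b [cg g01 g1 b0 gb]]].
exists (f \max g), (Num.min a b); split.
- by move=> x; apply: continuous_max; [exact: cf|exact: cg].
- move=> x /=; have /andP[? ?] := f01 x; have /andP[? ?] := g01 x.
  by rewrite le_max ge_max; apply/andP; split; apply/andP || apply/orP; [left|split].
- move=> x [/f1 fx|/g1 gx] /=; rewrite ?fx ?gx; have /andP[_ ?] := f01 x;
    have /andP[_ ?] := g01 x; by [apply/max_idPl|apply/max_idPr].
- by rewrite lt_min a0.
- move=> x y /=; rewrite lt_max => /orP[fx|gx] Gy.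
    by apply: le_trans (fa x y fx Gy); rewrite lee_fin ge_min lexx.
  by apply: le_trans (gb x y gx Gy); rewrite lee_fin ge_min lexx orbT.
Qed.

(** Where the minimum is positive both functions are, so the bound for whichever of [G] and [H]
    contains [y] applies. *)
Lemma separatedUr K G H : separated K G -> separated K H -> separated K (G `|` H).
Proof.
move=> [f [a [cf f01 f1 a0 fa]]] [g [b [cg g01 g1 b0 gb]]].
exists (f \min g), (Num.min a b); split.
- by move=> x; apply: continuous_min; [exact: cf|exact: cg].
- move=> x /=; have /andP[? ?] := f01 x; have /andP[? ?] := g01 x.
  by rewrite le_min ge_min; apply/andP; split; apply/andP || apply/orP; [split|left].
- by move=> x Kx /=; rewrite f1// g1// minxx.
- by rewrite lt_min a0.
- move=> x y /=; rewrite lt_min => /andP[fx gx] [Gy|Hy].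
    by apply: le_trans (fa x y fx Gy); rewrite lee_fin ge_min lexx.
  by apply: le_trans (gb x y gx Hy); rewrite lee_fin ge_min lexx orbT.
Qed.

Lemma separated_bigsetU K (F : nat -> set X) n :
  (forall i, separated K (F i)) -> separated K (\big[setU/set0]_(i < n) F i).
Proof.
move=> KF; elim: n => [|n IH]; first by rewrite big_ord0; exact: separated0r.
by rewrite big_ord_recr; exact: separatedUr.
Qed.

Variable dist : X -> X -> R.
Hypothesis mdist : metrizes dist.

Lemma separated_nbhs x y : lower_semicontinuous c -> (0 < c (x, y))%E ->
  exists A G, [/\ nbhs x A, nbhs y G & separated A G].
Proof.
move=> lsc c0.
(* The cost may be infinite at [(x, y)], but the bound [a] has to be finite. *)
have [a a0 ac] : exists2 a : R, 0 < a & (a%:E < c (x, y))%E.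
  case: (c (x, y)) c0 => [r|_|//]; last by exists 1; rewrite ?ltry.
  by rewrite lte_fin => r0; exists (r / 2); rewrite ?lte_fin; lra.
have [V [[A G] /= [nA nG] AGV] Vc] := lsc _ _ ac.
have [e e0 eA] := (nbhs_dist x A mdist).1 nA.
(* The slope [2 / e] makes [2 - k * dist x z] fall from 1 at distance [e / 2] to 0 at distance
   [e]. *)
have [k k0 ke] : exists2 k : R, 0 < k & k * e = 2.
  by exists (2 / e); rewrite ?divr_gt0// divfK// gt_eqF.
pose f : X -> R := cst 1 \min (cst 0 \max (fun z => 2 - k * dist x z)).
have fE z : f z = Num.min 1 (Num.max 0 (2 - k * dist x z)) by [].
exists [set z | dist x z < e / 2], G; split=> //.
  by apply/(nbhs_dist _ _ mdist); exists (e / 2) => //; lra.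
exists f, a; split=> //.
- move=> z; apply: continuous_min; first exact: cst_continuous.
  apply: continuous_max; first exact: cst_continuous.
  apply: continuousB; first exact: cst_continuous.
  by apply: continuousM; [exact: cst_continuous|exact: continuous_dist].
- by move=> z; rewrite fE le_min ler01 le_max lexx ge_min lexx.
- move=> z /= xz; rewrite fE; apply/min_idPl; rewrite le_max; apply/orP; right.
  have : k * dist x z <= k * (e / 2) by rewrite ler_pM2l// ltW.
  by rewrite mulrA ke; lra.
- move=> z w; rewrite fE lt_min lt_max ltxx /= => /andP[_ xz] Gw.
  apply/ltW/Vc/AGV; split => //=; apply: eA => /=.
  by rewrite -(ltr_pM2l k0) ke; lra.
Qed.

End Separation.

(** * Mass estimates for couplings of small cost *)

Section Transport.
Context (R : realType) (X : ptopologicalType).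

(** A form of Markov's inequality: [a] times the indicator of [A] is a simple function below [g],
    and the integral is the supremum over such functions. *)
Lemma ge0_integral_ge_cst d (T : measurableType d) (mu : measure T R)
    (g : T -> \bar R) (A : set T) (a : R) :
  measurable A -> 0 <= a -> (forall x, 0 <= g x)%E ->
  (forall x, A x -> a%:E <= g x)%E -> (a%:E * mu A <= \int[mu]_x g x)%E.
Proof.
move=> mA a0 g0 ag; rewrite ge0_integralTE//; apply: ereal_sup_ubound => /=.
exists (mul_nnsfun (cst_nnsfun T (NngNum a0)) (indic_nnsfun R mA)).
  move=> x /=; rewrite /mindic indicE; case: (pselect (A x)) => Ax.
    by rewrite mem_set// mulr1; exact: ag.
  by rewrite memNset// mulr0.
by rewrite (sintegralrM mu a (indic_nnsfun R mA)) sintegral_indic.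
Qed.

(** Let [U] be the set where [f] is positive, so that the integral of [f] is at most [eta U]. If the
    first coordinate is in [U], either the second avoids [G] or the pair is in [U] times [G]; there
    the cost is at least [a], which limits that mass to [e]. *)
Lemma coupling_bound (c : X * X -> \bar R) (eta nu : Prob R X) pi
    (K G : set X) (f : X -> R) (a e : R) :
  (forall z, 0 <= c z)%E -> separating c K G f a ->
  measurable (G : set (Borel X)) -> coupling eta nu pi ->
  (\int[pi]_z c z < (a * e)%:E)%E ->
  (\int[eta]_x (f x)%:E <= 1 - nu G + e%:E)%E.
Proof.
move=> c0 [cf f01 _ a0 fa] mG [pi1 pi2] ce.
have mf := continuous_measurable_Borel cf.
pose U : set (Borel X) := [set x | 0 < f x].
have mU : measurable U.
  apply: open_measurable_Borel; rewrite (_ : U = f @^-1` [set t | 0 < t])//.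
  by move/continuousP : cf; apply; exact: open_gt.
have mUX : measurable (fst @^-1` U : set (Borel X * Borel X)).
  by rewrite -[_ @^-1` _]setTI; exact: measurable_fst.
have mXG : measurable (snd @^-1` (~` G) : set (Borel X * Borel X)).
  by rewrite -[_ @^-1` _]setTI; apply: measurable_snd => //; exact: measurableC.
have mUG : measurable (U `*` G : set (Borel X * Borel X)) by exact: measurableX.
apply: (@le_trans _ _ (eta U)).
  have -> : eta U = (\int[eta]_x (\1_U x)%:E)%E by rewrite integral_indic// setIT.
  apply: ge0_le_integral => //.
  - by move=> x _; rewrite lee_fin; have /andP[] := f01 x.
  - exact/measurable_EFinP.
  - by apply/measurable_EFinP; exact: measurable_indic.
  - move=> x _; rewrite lee_fin indicE; have /andP[f0 f1] := f01 x.
    have [Ux|nUx] := pselect (U x); first by rewrite mem_set.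
    by rewrite memNset// leNgt; apply/negP.
rewrite -pi1//.
apply: (@le_trans _ _ (pi (snd @^-1` (~` G)) + pi (U `*` G))%E).
  apply: le_trans (measureU2 pi mXG mUG); apply: le_measure; rewrite ?inE//.
    exact: measurableU.
  move=> [x y] /= Ux; have [Gy|nGy] := pselect (G y); first by right.
  by left.
rewrite pi2; last exact: measurableC.
rewrite probability_setC//; apply: leeD => //.
have h : (a%:E * pi (U `*` G) <= (a * e)%:E)%E.
  apply: le_trans (ltW ce); apply: ge0_integral_ge_cst => //; first exact: ltW.
  by move=> [x y] [/= Ux Gy]; exact: fa.
by rewrite -(lee_pmul2l _ (_ : 0 < a%:E)%E)// -EFinM.
Qed.

End Transport.

(** * Zero transport cost along the diagonal *)

Section DiagonalCoupling.
Import HBNNSimple.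
Context (R : realType) (X : ptopologicalType).

Lemma OTcost_ge0 (c : X * X -> \bar R) (mu nu : Prob R X) :
  (forall z, 0 <= c z)%E -> (0 <= OTcost c mu nu)%E.
Proof. by move=> c0; apply: le_ereal_inf_tmp => _ [pi _ <-]; exact: integral_ge0. Qed.

(* No measurability of [g] is needed: the integral is computed on the simple
   functions below [g]. *)
Lemma ge0_integral_eq0 d (T : measurableType d) (mu : measure T R) (g : T -> \bar R) :
  (forall x, 0 <= g x)%E ->
  (forall A, measurable A -> (forall x, A x -> 0 < g x)%E -> mu A = 0%E) ->
  (\int[mu]_x g x = 0)%E.
Proof.
move=> g0 mu0; rewrite ge0_integralTE//; apply/eqP; rewrite eq_le; apply/andP; split.
  apply: ub_ereal_sup => _ [h hg <-]; rewrite sintegralE fsbig1// => r _.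
  have [->|r0] := eqVneq r 0; first by rewrite mul0e.
  rewrite mu0 ?mule0// => x /= hx; apply: lt_le_trans (hg x).
  by rewrite lte_fin hx lt_neqAle eq_sym r0 -hx fun_ge0.
apply: ereal_sup_ubound; exists (cst_nnsfun _ 0%:nng) => //=.
by rewrite sintegral0.
Qed.

Lemma OTcost_diag (c : X * X -> \bar R) (mu nu : Prob R X) :
  (forall z, 0 <= c z)%E -> (forall x, c (x, x) = 0%E) -> meq nu mu ->
  OTcost c mu nu = 0%E.
Proof.
move=> c0 cxx numu; apply/eqP; rewrite eq_le OTcost_ge0// andbT.
have mdiag : measurable_fun [set: Borel X]
    (fun x : Borel X => (x, x) : (Borel X * Borel X)%type).
  by apply: measurable_fun_pair; exact: measurable_id.
pose diag : {RV mu >-> (Borel X * Borel X)%type} := mfun_Sub (mem_set mdiag).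
apply: ereal_inf_lbound; exists (distribution mu diag).
  by split=> [//|A mA]; rewrite numu.
(* A set on which [c] is positive misses the diagonal, which carries the whole pushforward. *)
apply: ge0_integral_eq0 => // A _ Ac.
have dA0 : diag @^-1` A = set0.
  by rewrite -subset0 => x /Ac; rewrite /= cxx ltxx.
by rewrite [LHS](_ : _ = mu (diag @^-1` A))// dA0 measure0.
Qed.

End DiagonalCoupling.

(** * Comparing the weak limit [mu] with [nu] *)

Section WeakLimit.
Context (R : realType) (X : ptopologicalType) (c : X * X -> \bar R).
Hypothesis c0 : forall z, (0 <= c z)%E.
Context (mu nu : Prob R X) (eta_ : nat -> Prob R X).
Hypothesis eta_mu : weak_cvg eta_ mu.
Hypothesis eta_nu : forall e : R, 0 < e ->
  \forall n \near \oo, (OTcost c (eta_ n) nu < e%:E)%E.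

Lemma separated_measure_le (K G : set X) : separated c K G -> closed K ->
  measurable (G : set (Borel X)) -> (mu K <= 1 - nu G)%E.
Proof.
move=> [f [a KGf]] cK mG; have [cf f01 f1 a0 _] := KGf.
have mf := continuous_measurable_Borel cf.
have mK := closed_measurable_Borel cK.
apply: (@le_trans _ _ (\int[mu]_x (f x)%:E)%E).
  have -> : mu K = (\int[mu]_x (\1_K x)%:E)%E.
    by rewrite (integral_indic mu measurableT mK) setIT.
  apply: ge0_le_integral => //.
  - by apply/measurable_EFinP; exact: measurable_indic.
  - exact/measurable_EFinP.
  - move=> x _; rewrite lee_fin indicE; have /andP[f0 _] := f01 x.
    have [Kx|nKx] := pselect (K x); first by rewrite mem_set// f1.
    by rewrite memNset.
apply/lee_addgt0Pr => e e0.
have fbnd : exists M : R, forall x, `|f x| <= M.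
  by exists 1 => x; have /andP[f0 f1x] := f01 x; rewrite ger0_norm.
apply: cvge_to_le (eta_mu cf fbnd) _.
(* Cost below [a * e] is what [coupling_bound] turns into an error [e]. *)
have ae : 0 < a * e by rewrite mulr_gt0.
near=> n.
have : (OTcost c (eta_ n) nu < (a * e)%:E)%E by near: n; exact: eta_nu.
move=> /ereal_inf_lt[_ [pi cpi <-]]; exact: coupling_bound KGf mG cpi.
Unshelve. all: by end_near. Qed.

Context (d : X -> X -> R).
Hypotheses (md : metrizes d) (cd : cauchy_complete d).
Hypothesis sepX : exists S : set X, countable S /\ dense S.
Hypothesis lsc : lower_semicontinuous c.
Hypothesis c_gt0 : forall x y, x <> y -> (0 < c (x, y))%E.

Lemma compact_measure_le (K : set X) : closed K -> tot_bounded d K ->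
  (mu K <= nu K)%E.
Proof.
move=> cK tK; have [s sdense] := dense_seq sepX.
have [rad [rad0 _ rsmall]] := @vanishing_radii R.
have mK := closed_measurable_Borel cK.
(* For fixed [y], induction over the compact set [K]: a union takes the smaller of the two radii
   around [y]. *)
have Kball y : ~ K y -> exists2 e : R, 0 < e & separated c K [set z | d y z < e].
  move=> nKy; apply: (tot_bounded_ind md cd cK tK
    (P := fun A => exists2 e : R, 0 < e & separated c A [set z | d y z < e])).
  - by exists 1 => //; exact: separated0l.
  - by move=> A B AB [e e0 eB]; exists e => //; exact: separatedS eB.
  - move=> A B [e e0 eA] [e' e'0 e'B]; exists (Num.min e e'); first by rewrite lt_min e0.
    apply: separatedUl; [apply: separatedS eA|apply: separatedS e'B] => // z /=;
      by rewrite lt_min => /andP[].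
  - move=> x Kx; have xy : x <> y by move=> xy; apply: nKy; rewrite -xy.
    have [A [G [nA nG AG]]] := separated_nbhs md lsc (c_gt0 xy).
    have [e e0 eG] := (nbhs_dist y G md).1 nG.
    by exists A => //; exists e => //; exact: separatedS AG.
(* [B] runs through a countable base of balls, with the empty set at indices coding no pair; [H]
   keeps those separated from [K]. *)
pose B n := if @unpickle (nat * nat)%type n is Some (i, k)
  then [set z | d (s i) z < rad k] else set0.
pose H n := if `[< separated c K (B n) >] then B n else set0.
have KH n : separated c K (H n).
  by rewrite /H; case: asboolP => // _; exact: separated0r.
have mH n : measurable (H n : set (Borel X)).
  rewrite /H; case: asboolP => // _; rewrite /B.
  case: (unpickle n) => [[i k]|//]; apply: open_measurable_Borel.
  exact: open_ball_dist.
have Hcover : ~` K `<=` \bigcup_n H n.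
  move=> y /Kball[e e0 Ke]; have /rsmall[k ke] : 0 < e / 2 by lra.
  have [|i yi] := sdense _ (open_ball_dist y (rad k) md).
    by exists y; rewrite /= distxx.
  have BE : B (pickle (i, k)) = [set z | d (s i) z < rad k] by rewrite /B pickleK.
  exists (pickle (i, k)) => //; rewrite /H; case: asboolP => [_|]; rewrite BE /=.
    by rewrite (dist_sym md).
  (* Since [rad k < e / 2], a ball of radius [rad k] containing [y] lies in the ball of radius [e]
     around [y]. *)
  case; apply: separatedS Ke => // z /= iz.
  have := dist_triangle md y (s i) z; move: yi ke iz => /=; lra.
have : (nu (~` K) <= 1 - mu K)%E.
  apply: (@measure_le_exhaustion _ _ _ nu (fun n => \big[setU/set0]_(i < n) H i)).
  - by move=> n; apply: bigsetU_measurable.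
  - by move=> m n; exact: (@subset_bigsetU _ H).
  - exact: measurableC.
  - by rewrite -(bigcup_bigsetU_bigcup H) in Hcover; move=> y /Hcover[n _ Hn]; exists n.+1.
  - move=> n; have mHn : measurable (\big[setU/set0]_(i < n) H i : set (Borel X)).
      by apply: bigsetU_measurable.
    have := separated_measure_le (separated_bigsetU n KH) cK mHn.
    rewrite -[X in (_ -> X <= _)%E]/(nu (\big[setU/set0]_(i < n) H i)).
    rewrite -(fineK (fin_num_measure mu K mK)) -(fineK (fin_num_measure nu _ mHn)).
    by rewrite -!EFinB !lee_fin; lra.
rewrite probability_setC//.
rewrite -(fineK (fin_num_measure mu K mK)) -(fineK (fin_num_measure nu K mK)).
by rewrite -!EFinB !lee_fin; lra.
Qed.

Lemma closed_measure_le (F : set X) : closed F -> (mu F <= nu F)%E.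
Proof.
move=> cF; have mF := closed_measurable_Borel cF.
apply/lee_addgt0Pr => e e0.
have [K [cK tK Ke]] := tightness mu md sepX e0.
have mK := closed_measurable_Borel cK.
have mFK : measurable (F `&` K : set (Borel X)) by exact: measurableI.
apply: (@le_trans _ _ (mu (F `&` K) + mu (~` K))%E).
  apply: le_trans (measureU2 mu mFK (measurableC mK)).
  apply: le_measure; rewrite ?inE//; first by apply: measurableU => //; exact: measurableC.
  by move=> x Fx; have [Kx|nKx] := pselect (K x); [left|right].
apply: leeD => //; apply: (@le_trans _ _ (nu (F `&` K))).
  apply: compact_measure_le; first exact: closedI.
  by move=> r /tK[t tP]; exists t => x [_ /tP].
by apply: le_measure; rewrite ?inE//; exact: subIsetl.
Qed.

Lemma weak_limit_meq : meq nu mu.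
Proof.
have open_le O : open O -> (mu O <= nu O)%E.
  move=> oO; have [rad [rad0 radle rsmall]] := @vanishing_radii R.
  (* Points at distance at least [rad n] from the complement of [O]: closed sets increasing to [O].
     Quantifying over [y] also covers an empty complement. *)
  pose F n := [set x | forall y, ~ O y -> rad n <= d x y].
  have cF n : closed (F n).
    rewrite -openC; apply/(open_dist md) => x /= /existsNP[y /not_implyP[nOy /negP]].
    rewrite -ltNge => xy; exists (rad n - d x y); first by rewrite subr_gt0.
    move=> z xz /(_ y nOy); have := dist_triangle md z x y; move: xz => /=.
    by rewrite (dist_sym md z x); lra.
  have FO n : F n `<=` O.
    move=> x Fx; apply: contrapT => /Fx; rewrite distxx// => r0.
    by have := rad0 n; rewrite ltNge r0.
  apply: (@measure_le_exhaustion _ _ _ mu F).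
  - by move=> n; exact: closed_measurable_Borel.
  - move=> m n mn x Fx y /Fx; apply: le_trans; exact: radle.
  - exact: open_measurable_Borel.
  - move=> x Ox; have [e e0 eO] := (open_dist md O).1 oO x Ox.
    have [k ke] := rsmall e e0; exists k => // y nOy.
    by rewrite leNgt; apply/negP => xy; apply: nOy; apply: eO => /=; lra.
  - move=> n; apply: le_trans (closed_measure_le (cF n)) _.
    apply: le_measure; rewrite ?inE//; first exact: closed_measurable_Borel.
    exact: open_measurable_Borel.
have open_eq (O : set (Borel X)) : open (O : set X) -> nu O = mu O.
  move=> oO; have mO := open_measurable_Borel oO.
  apply/eqP; rewrite eq_le open_le// andbT.
  have cO : closed (~` O : set X) by rewrite closedC.
  (* Both measures have total mass 1, so the inequality on the closed complement reverses on [O]. *)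
  have := closed_measure_le cO.
  rewrite !probability_setC//.
  rewrite -(fineK (fin_num_measure mu O mO)) -(fineK (fin_num_measure nu O mO)).
  by rewrite -!EFinB !lee_fin; lra.
move=> A mA.
(* The open sets are stable under intersection and generate the Borel sets. *)
apply: (@measure_unique _ R (Borel X) (@open X) (fun=> setT) erefl (@openI X)
  _ _ nu mu open_eq _ A mA).
- by move=> _; exact: openT.
- by rewrite bigcup_const//; exists 0.
- by move=> _; rewrite [ltLHS](probability_setT nu) ltry.
Qed.

End WeakLimit.

(** * The divergence property of [Dc] *)

Theorem theorem1 (R : realType) (X : ptopologicalType)
  (D : Prob R X -> Prob R X -> \bar R) (c : X * X -> \bar R) :
  polish R X ->
  pre_divergence D ->
  cost_function c ->
  (forall (mu_ : nat -> Prob R X) (mu : Prob R X),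
     (fun n => D (mu_ n) mu) @ \oo --> 0%E -> weak_cvg mu_ mu) ->
  (forall x1 x2 : X, c (x1, x2) = 0%E <-> x1 = x2) ->
  forall mu nu : Prob R X, Dc D c nu mu = 0%E <-> meq nu mu.
Proof.
move=> [[d [[d0 deq] dsym dtri dopen cd]] sepX] [D0 Dxx] [lsc c0] Dweak cdiag mu nu.
have md : metrizes d by split.
have Dc0 eta : (0 <= D eta mu + OTcost c eta nu)%E.
  by apply: adde_ge0 => //; exact: OTcost_ge0.
split=> [Dcnu|numu]; last first.
  apply/eqP; rewrite eq_le; apply/andP; split.
    apply: ereal_inf_lbound; exists mu => //.
    by rewrite Dxx add0e OTcost_diag// => x; exact/cdiag.
  by apply: le_ereal_inf_tmp => _ [eta _ <-].
(* Both summands are nonnegative, so near-minimizers for the infimum 0 make each of them tend to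
   0. *)
have /choice[eta_ etaP] n : exists eta : Prob R X,
    (D eta mu + OTcost c eta nu < n.+1%:R^-1%:E)%E.
  have : (Dc D c nu mu < n.+1%:R^-1%:E)%E by rewrite Dcnu lte_fin invr_gt0.
  by move=> /ereal_inf_lt[_ [eta _ <-]]; exists eta.
have eta_mu : weak_cvg eta_ mu.
  apply: Dweak; apply: (squeeze_cvge _ (cvg_cst _) cvge_harmonic).
  apply: nearW => n; rewrite D0 /=; apply: le_trans (ltW (etaP n)).
  by rewrite leeDl// OTcost_ge0.
apply: (weak_limit_meq c0 eta_mu _ md cd sepX lsc) => [e e0|x y xy].
  have [N _ NP] := near_infty_natSinv_lt (PosNum e0).
  exists N => // n /= /NP /= ne; apply: le_lt_trans (lt_trans (etaP n) _).
    by rewrite leeDr.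
  by rewrite lte_fin.
by rewrite lt_neqAle c0 andbT eq_sym; apply/eqP => /cdiag.
Qed.
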